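(* Let $\mathbb{S}$ be a separable Banach space and let $\mathbf{P}_{\mathbb{S}}\colon V_{\mathbb{S}}\to\mathbb{S}$ be a non-expansive linear operator with the left-Gurariĭ property (with respect to $\mathbb{S}$), where $V_{\mathbb{S}}$ is a separable Banach space. Given finite-dimensional subspaces $X_0,X_1$ of $V_{\mathbb{S}}$ and a linear isometry $h\colon X_0\to X_1$ such that $\mathbf{P}_{\mathbb{S}}\circ h=\mathbf{P}_{\mathbb{S}}\restriction X_0$, for every $\varepsilon>0$ there exists a bijective linear isometry $H\colon V_{\mathbb{S}}\to V_{\mathbb{S}}$ satisfying $\mathbf{P}_{\mathbb{S}}\circ H=\mathbf{P}_{\mathbb{S}}$ and $\|H\restriction X_0-h\|<\varepsilon$.
   Context: All spaces are over a fixed scalar field ($\mathbb{R}$ or $\mathbb{C}$). An operator is non-expansive if its norm is at most $1$. For $\varepsilon>0$, an $\varepsilon$-embedding is a linear operator $f$ satisfying $(1-\varepsilon)\|x\|\le\|f(x)\|\le(1+\varepsilon)\|x\|$ for every $x$ in its domain. Left-Gurariĭ property (with respect to a fixed separable Banach space $\mathbb{S}$): a linear operator $P\colon V\to\mathbb{S}$ has it if for all finite-dimensional normed spaces $X_0\subseteq X$, every non-expansive linear operator $T\colon X\to\mathbb{S}$, every linear isometric embedding $e\colon X_0\to V$ such that $P\circ e=T\restriction X_0$, and every $\varepsilon>0$, there exists an $\varepsilon$-embedding $f\colon X\to V$ satisfying $\|f\restriction X_0-e\|\le\varepsilon$ and $\|P\circ f-T\|\le\varepsilon$. A non-expansive operator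 with this property and with separable Banach domain is known to exist for each separable $\mathbb{S}$; it is denoted $\mathbf{P}_{\mathbb{S}}\colon V_{\mathbb{S}}\to\mathbb{S}$. *)

(* Defs.v *)
From HB Require Import structures.
From mathcomp Require Import all_boot all_order all_algebra.
From mathcomp Require Import all_classical all_reals all_analysis.
From mathcomp Require Import complex.

Set Implicit Arguments.
Unset Strict Implicit.
Unset Printing Implicit Defensive.

Import Order.TTheory GRing.Theory Num.Theory.
Import numFieldNormedType.Exports.
Local Open Scope classical_set_scope.
Local Open Scope ring_scope.

Definition real_or_complex (R : realType) (K : numFieldType) : Prop :=
  K = (R : numFieldType) \/ K = (complex R : numFieldType).

Definition separable_space (T : topologicalType) : Prop :=
  exists2 D : set T, countable D & dense D.

Section operators.
Variable K : numFieldType.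

Definition findim_subspace (V : lmodType K) (A : set V) : Prop :=
  exists (n : nat) (v : 'I_n -> V),
    A = range (fun c : 'I_n -> K => \sum_(i < n) c i *: v i).

(* An operator defined only on a subspace A of V is encoded as a function on V
   whose values outside A are irrelevant. *)
Definition linear_on (V W : lmodType K) (A : set V) (f : V -> W) : Prop :=
  forall (a : K) (x y : V), A x -> A y -> f (a *: x + y) = a *: f x + f y.

Definition linear_isometry_on (V W : normedModType K) (A : set V) (f : V -> W)
    : Prop :=
  linear_on A f /\ forall x, A x -> `|f x| = `|x|.

(* Norms take values in K (nonnegative reals inside K); the supremum is taken
   in \bar K, so that it is +oo when f is unbounded on A. For K = R[i] the
   order is the partial one, where 0 < eps forces eps to be real. *)
Definition opnorm (V W : normedModType K) (A : set V) (f : V -> W) : \bar K :=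
  supremum -oo%E [set (`|f x|)%:E | x in [set x | A x /\ `|x| <= 1]].

Definition nonexpansive (V W : normedModType K) (f : V -> W) : Prop :=
  (opnorm [set: V] f <= 1)%E.

Definition eps_embedding (V W : normedModType K) (eps : K)
    (f : {linear V -> W}) : Prop :=
  forall x, (1 - eps) * `|x| <= `|f x| /\ `|f x| <= (1 + eps) * `|x|.

Definition left_gurarii (V S : normedModType K) (P : {linear V -> S}) : Prop :=
  forall (X : normedModType K) (X0 : set X) (T : {linear X -> S})
         (e : X -> V) (eps : K),
    findim_subspace [set: X] -> findim_subspace X0 ->
    nonexpansive T ->
    linear_isometry_on X0 e ->
    (forall x, X0 x -> P (e x) = T x) ->
    0 < eps ->
    exists f : {linear X -> V},
      [/\ eps_embedding eps f,
          (opnorm X0 (fun x => f x - e x)%R <= eps%:E)%E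
        & (opnorm [set: X] (fun x => P (f x) - T x)%R <= eps%:E)%E].

End operators.

(* Main.v *)
Require Import Defs.
From HB Require Import structures.
From mathcomp Require Import all_boot all_order all_algebra.
From mathcomp Require Import all_classical all_reals all_analysis.
From mathcomp Require Import complex ring.
Import Order.TTheory GRing.Theory Num.Theory.
Import numFieldNormedType.Exports.
Local Open Scope classical_set_scope.
Local Open Scope ring_scope.
Set Implicit Arguments.
Unset Strict Implicit.
Unset Printing Implicit Defensive.

(** The isometry is the limit of a back-and-forth between finite-dimensional
    subspaces of [V].

    The link between the left-Gurarii property and almost isometries is a
    gluing of norms. Let [f : A -> B] be an [e]-isometry between
    finite-dimensional subspaces of [V] with [|P (f x) - P x| <= e |x|]. On the
    direct sum of [A] and [B] put the norm
    [N (x, y) = inf_w |x - w| + |y + f w| + e |w|], [w] in [A]. Both summands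
    embed isometrically (this uses the two bounds on [|f w|]), the elements
    [(x, - f x)] have norm at most [e |x|], and [(x, y) |-> P x + P y] is
    non-expansive (this uses the bound on [P (f x) - P x]). The left-Gurarii
    property applied to this space, with the inclusion of [A] into [V], gives
    an almost isometry whose restriction [g] to [B] almost commutes with [P]
    and is an approximate left inverse of [f], with an error of the order of
    [e], while [g] itself is as close to an isometry as desired
    ([approx_iso_inverse]).

    Iterating with errors [e / 2 ^+ n], and adding at each stage one more term
    of a dense sequence, gives subspaces [A n] and maps [f n] from [A n] to
    [A n.+1] such that [f n.+1 \o f n] is close to the identity
    ([back_and_forth]). Along even indices the maps [f n] form a Cauchy
    sequence; their limit [H] is a linear isometry commuting with [P], and it
    stays within [24 * e] of the initial map on [X0]. Along odd indices the
    maps [f n] show that [H] has dense range, hence [H] is onto because [V] is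
    complete ([limit_isometry]).

    Norms have values in the scalar field [K], real or complex. The only order
    property of [K] used is that nonempty sets of nonnegative elements have an
    infimum. *)

(** * Scalars *)

(** Completeness of the order, restricted to sets of nonnegative elements so
    that it also makes sense for the partial order of the complex numbers. *)
Definition order_complete (K : numFieldType) : Prop :=
  forall A : set K, A !=set0 -> (forall a, A a -> 0 <= a) ->
  infimums A !=set0.

Lemma order_complete_real (R : realType) : order_complete R.
Proof.
move=> A A0 Age; exists (inf A); split=> [a Aa|l lA].
  by apply: ge_inf => //; exists 0 => b /Age.
exact: lb_le_inf.
Qed.

Lemma order_complete_complex (R : realType) : order_complete (complex R).
Proof.
move=> A [a0 Aa0] Age.
have ImA a : A a -> complex.Im a = 0.
  by move=> /Age; rewrite lecE /= => /andP[/eqP].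
have ReA a : A a -> 0 <= complex.Re a by move=> /Age; rewrite lecE /= => /andP[].
pose B : set R := [set complex.Re a | a in A].
have [m [mB mglb]] : infimums B !=set0.
  apply: order_complete_real; first by exists (complex.Re a0); exists a0.
  by move=> _ [a /ReA ? <-].
exists (Complex m 0); split=> [a Aa|l lA].
  by rewrite lecE /= ImA // eqxx mB //; exists a.
have := lA _ Aa0; rewrite lecE ImA // => /andP[/eqP Iml _].
rewrite lecE /= Iml eqxx /=; apply: mglb => _ [a Aa <-].
by have := lA _ Aa; rewrite lecE => /andP[].
Qed.

Lemma real_or_complex_order_complete (R : realType) (K : numFieldType) :
  real_or_complex R K -> order_complete K.
Proof.
by case=> ->; [exact: order_complete_real | exact: order_complete_complex].
Qed.

Section Scalars.
Variables (K : numFieldType) (hK : order_complete K).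
Implicit Types (A : set K) (x y c m l e : K).

Lemma glb_approx A m e : infimums A m -> (forall a, A a -> 0 <= a) ->
  0 < e -> exists2 a, A a & a < m + e.
Proof.
move=> [mA mglb] Age e0; apply: contrapT => hn.
have m0 : 0 <= m by apply: mglb.
suff : m + e <= m by rewrite gerDl => /le_lt_trans /(_ e0); rewrite ltxx.
have me0 : 0 <= m + e by rewrite addr_ge0 // ltW.
apply: mglb => a Aa; rewrite real_leNgt; [|exact: ger0_real|exact/ger0_real/Age].
by apply/negP => am; apply: hn; exists a.
Qed.

(** An inequality that holds up to [c * d] for every positive [d] holds. The
    two sides have to be real for the order to be total on them. *)
Lemma le_of_small x y c : x \is Num.real -> y \is Num.real -> 0 < c ->
  (forall d, 0 < d -> x <= y + c * d) -> x <= y.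
Proof.
move=> xr yr c0 hd; rewrite real_leNgt //; apply/negP => yx.
have xy0 : 0 < x - y by rewrite subr_gt0.
have := hd ((x - y) / (2 * c)) _; rewrite divr_gt0 ?mulr_gt0 ?ltr0n //.
have -> : c * ((x - y) / (2 * c)) = (x - y) / 2 by field; rewrite gt_eqF.
move=> /(_ isT); rewrite -lerBlDl ler_pdivlMr ?ltr0n // ger_pMr //.
by rewrite -[1]/(1%:R) ler_nat.
Qed.

(** The Archimedean property is not assumed of [K]: it follows from the
    existence of infima. *)
Lemma geometric_small c e : 0 < c -> 0 < e ->
  exists N, forall n, (N <= n)%N -> c / 2 ^+ n < e.
Proof.
move=> c0 e0.
have pos n : 0 < c / 2 ^+ n :> K by rewrite divr_gt0 // exprn_gt0 // ltr0n.
have [||m mglb] := hK (A := range (fun n => c / 2 ^+ n)).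
- by exists (c / 2 ^+ 0), 0%N.
- by move=> _ [n _ <-]; exact: ltW.
(* The infimum [m] of the halvings satisfies [2 * m <= m], so it is [0]. *)
have m2 : m *+ 2 <= m.
  apply: mglb.2 => _ [n _ <-].
  have /mglb.1 : range (fun n => c / 2 ^+ n) (c / 2 ^+ n.+1) by exists n.+1.
  rewrite -[m *+ 2]mulr_natr -ler_pdivlMr ?ltr0n // => /le_trans; apply.
  by rewrite exprS invfM mulrA -mulrA [2^-1 * _]mulrC mulrA.
have m0 : m <= 0 by rewrite -(lerD2l m) addr0 -mulr2n.
have [|_ [N _ <-] Ne] := glb_approx mglb _ e0.
  by move=> _ [n _ <-]; exact: ltW.
exists N => n Nn; apply: le_lt_trans (lt_le_trans Ne _); last first.
  by rewrite -[leRHS]add0r lerD2r.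
rewrite ler_pM2l // lef_pV2 ?posrE ?exprn_gt0 ?ltr0n //.
by rewrite ler_weXn2l // ler1n.
Qed.

(** In [\bar K] the order is partial when [K] is complex, so suprema are not
    automatic. *)
Lemma ereal_supremum_exists (E : set K) : E !=set0 -> (forall a, E a -> 0 <= a) ->
  supremums (EFin @` E) !=set0.
Proof.
move=> [a0 Ea0] Ege.
have [[u Eu]|noub] := pselect (exists u, forall a, E a -> a <= u).
  have [||m [mU mglb]] := hK (A := [set u | forall a, E a -> a <= u]).
  - by exists u.
  - by move=> v /(_ _ Ea0); apply: le_trans; exact: Ege.
  exists m%:E; split=> [_ [a Ea <-]|[v| |]] //=.
  - by rewrite lee_fin; apply: mglb => v; apply.
  - move=> hv; rewrite lee_fin; apply: mU => a Ea.
    by have : (a%:E <= v%:E)%E by [apply: hv; exists a]; rewrite lee_fin.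
  - move=> _; apply: ger0_real; apply: le_trans (Ege _ Ea0) _.
    by apply: mglb => v; apply.
  - by move=> /(_ a0%:E) hv; have : (a0%:E <= -oo :> \bar K)%E by apply: hv; exists a0.
exists +oo%E; split=> [_ [a Ea <-]|[v| |]] //=.
- by rewrite /Order.le /=; exact: ger0_real (Ege _ Ea).
- move=> hv; exfalso; apply: noub; exists v => a Ea.
  by have : (a%:E <= v%:E)%E by [apply: hv; exists a]; rewrite lee_fin.
- by move=> /(_ a0%:E) hv; have : (a0%:E <= -oo :> \bar K)%E by apply: hv; exists a0.
Qed.

End Scalars.

(** * Operator norms *)
Section Opnorm.
Variables (K : numFieldType) (V W : normedModType K).
Implicit Types (A : set V) (f : V -> W) (c : K).

Lemma opnorm_le A f c : 0 <= c ->
  (forall x, A x -> `|f x| <= c * `|x|) -> (opnorm A f <= c%:E)%E.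
Proof.
move=> c0 hf; rewrite /opnorm /supremum; case: ifP => [_|_].
  by rewrite /Order.le /=; exact: ger0_real.
case: xgetP => [s _ [_ hs]|_].
  apply: hs => _ [x [Ax x1] <-]; rewrite lee_fin (le_trans (hf _ Ax)) //.
  by rewrite -[leRHS]mulr1 ler_wpM2l.
by rewrite /Order.le /=; exact: ger0_real.
Qed.

(** The existence of the supremum in [\bar K] matters here: a missing supremum
    would make [opnorm A f] equal to [-oo]. *)
Lemma le_opnorm A f c (hK : order_complete K) :
  (forall a x, A x -> A (a *: x) /\ f (a *: x) = a *: f x) ->
  (opnorm A f <= c%:E)%E -> forall x, A x -> `|f x| <= c * `|x|.
Proof.
move=> fZ; move=> hc x Ax.
pose E := [set `|f z| | z in [set z | A z /\ `|z| <= 1]].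
have hE : opnorm A f = supremum -oo%E (EFin @` E) by rewrite /opnorm /E image_comp.
have [x0|x0] := eqVneq x 0.
  by have := (fZ 0 x Ax).2; rewrite !scale0r x0 => ->; rewrite !normr0 mulr0.
have nx0 : 0 < `|x| by rewrite normr_gt0.
set y := (`|x|^-1 *: x).
have [Ay fy] := fZ `|x|^-1 _ Ax.
suff : `|f y| <= c.
  by rewrite fy normrZ normfV normr_id mulrC ler_pdivrMr.
rewrite -lee_fin; apply: le_trans hc.
have Ey : E `|f y|.
  by exists y => //; split=> //; rewrite normrZ normfV normr_id mulVf ?gt_eqF.
have [s sS] : supremums (EFin @` E) !=set0.
  by apply: ereal_supremum_exists => // [|_ [z _ <-]] //; exists `|f y|.
rewrite hE /supremum ifF; last first.
  by apply/negP => /eqP E0; have := image_f EFin (mem_set Ey); rewrite E0 inE.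
by case: xgetP => [t _ [tU _]|/(_ s) //]; apply: tU; exists `|f y|.
Qed.

End Opnorm.

(** * Finite-dimensional subspaces *)
Section Submodules.
Variable K : numFieldType.

(** Linear subspaces, as sets. *)
Definition submodule (V : lmodType K) (A : set V) : Prop :=
  A 0 /\ forall a x y, A x -> A y -> A (a *: x + y).

Section Closure.
Variables (V : lmodType K) (A : set V) (hA : submodule A).

Lemma submodule0 : A 0. Proof. by case: hA. Qed.

Lemma submoduleZ a x : A x -> A (a *: x).
Proof. by move=> Ax; rewrite -[_ *: _]addr0; apply: hA.2 => //; exact: hA.1. Qed.

Lemma submoduleD x y : A x -> A y -> A (x + y).
Proof. by move=> Ax Ay; rewrite -[x]scale1r; exact: hA.2. Qed.

Lemma submoduleB x y : A x -> A y -> A (x - y).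
Proof. by move=> Ax Ay; rewrite addrC -scaleN1r; exact: hA.2. Qed.

Variables (W : lmodType K) (f : V -> W) (fL : linear_on A f).

Lemma linear_on0 : f 0 = 0.
Proof.
have := fL 1 submodule0 submodule0; rewrite !scale1r addr0 => /eqP.
by rewrite -subr_eq subrr eq_sym => /eqP.
Qed.

Lemma linear_onZ a x : A x -> f (a *: x) = a *: f x.
Proof.
move=> Ax; rewrite -[a *: x]addr0 fL ?linear_on0 ?addr0 //.
exact: submodule0.
Qed.

Lemma linear_onD x y : A x -> A y -> f (x + y) = f x + f y.
Proof. by move=> Ax Ay; rewrite -[x]scale1r fL // !scale1r. Qed.

Lemma linear_onB x y : A x -> A y -> f (x - y) = f x - f y.
Proof. by move=> Ax Ay; rewrite addrC -scaleN1r fL // scaleN1r addrC. Qed.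

Lemma linear_on_sum n (v : 'I_n -> V) (c : 'I_n -> K) :
  (forall i, A (v i)) ->
  f (\sum_(i < n) c i *: v i) = \sum_(i < n) c i *: f (v i).
Proof.
move=> Av; suff [] : A (\sum_(i < n) c i *: v i) /\
    f (\sum_(i < n) c i *: v i) = \sum_(i < n) c i *: f (v i) by [].
elim/big_ind2: _ => [|x1 x2 y1 y2 [Ax1 <-] [Ay1 <-]|i _].
- by split; [exact: submodule0|exact: linear_on0].
- by split; [exact: submoduleD|exact: linear_onD].
- by split; [exact: submoduleZ|exact: linear_onZ].
Qed.

End Closure.

Lemma findim_submodule (V : lmodType K) (A : set V) :
  findim_subspace A -> submodule A.
Proof.
move=> [n [v ->]]; split.
  by exists (fun=> 0) => //; rewrite big1 // => i _; rewrite scale0r.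
move=> a _ _ [c _ <-] [d _ <-]; exists (fun i => a * c i + d i) => //.
by rewrite scaler_sumr -big_split; apply: eq_bigr => i _; rewrite scalerA scalerDl.
Qed.

Lemma findim_span_mem (V : lmodType K) n (v : 'I_n -> V) i :
  range (fun c : 'I_n -> K => \sum_(i < n) c i *: v i) (v i).
Proof.
exists (fun j => (j == i)%:R) => //.
rewrite (bigD1 i) //= eqxx scale1r big1 ?addr0 // => j /negPf->.
by rewrite scale0r.
Qed.

Lemma findim_line (V : lmodType K) (v : V) :
  findim_subspace (range (fun c : K => c *: v)).
Proof.
exists 1%N, (fun=> v); apply/seteqP; split=> _ [c _ <-].
  by exists (fun=> c) => //; rewrite big_ord1.
by exists (c ord0) => //; rewrite big_ord1.
Qed.

Lemma findim_add (V : lmodType K) (A B : set V) :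
  findim_subspace A -> findim_subspace B ->
  findim_subspace [set x + y | x in A & y in B].
Proof.
move=> [n [v ->]] [m [w ->]].
exists (n + m)%N, (fun i : 'I_(n + m) =>
  match fintype.split i with inl j => v j | inr j => w j end).
apply/seteqP; split.
  move=> _ [_ [c _ <-]] [_ [d _ <-]] <-.
  exists (fun i => match fintype.split i with inl j => c j | inr j => d j end) => //.
  rewrite big_split_ord /=; congr (_ + _); apply: eq_bigr => i _.
    by rewrite (unsplitK (inl i)).
  by rewrite (unsplitK (inr i)).
move=> _ [c _ <-].
exists (\sum_(i < n) c (lshift m i) *: v i); first by exists (c \o @lshift n m).
exists (\sum_(i < m) c (rshift n i) *: w i); first by exists (c \o @rshift n m).
rewrite big_split_ord /=; congr (_ + _); apply: eq_bigr => i _.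
  by rewrite (unsplitK (inl i)).
by rewrite (unsplitK (inr i)).
Qed.

Lemma findim_image (V W : lmodType K) (A : set V) (f : V -> W) :
  findim_subspace A -> linear_on A f -> findim_subspace (f @` A).
Proof.
move=> fA fL; have sA := findim_submodule fA.
case: fA fL sA => n [v ->] fL sA.
exists n, (f \o v); rewrite image_comp; apply: eq_imagel => c _ /=.
by rewrite (linear_on_sum sA fL) // => i; exact: findim_span_mem.
Qed.

End Submodules.

(** * Subspaces as modules *)
Section SubmoduleType.
Variables (K : numFieldType) (V : lmodType K) (A : set V) (hA : submodule A).

(** The membership predicate carries the proof that the set is a subspace, so
    that the algebraic structures can be inferred from it. *)
Definition submodule_pred of submodule A : {pred V} := fun x => x \in A.

Let P := submodule_pred hA.

Fact submodule_pred_closed : submod_closed P.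
Proof.
split=> [|a x y]; rewrite /P !unfold_in /submodule_pred ?inE; first exact: hA.1.
exact: hA.2.
Qed.
HB.instance Definition _ := GRing.isSubmodClosed.Build K V P submodule_pred_closed.

(** The subspace [A] as a module of its own. *)
Record submodule_type := SubmoduleType {
  submodule_val : V; _ : submodule_val \in P }.

HB.instance Definition _ := [isSub for submodule_val].
HB.instance Definition _ := [Choice of submodule_type by <:].
HB.instance Definition _ := [SubChoice_isSubLmodule of submodule_type by <:].

Lemma submodule_valP (x : submodule_type) : A (val x).
Proof. by have := valP x; rewrite unfold_in /= /submodule_pred inE. Qed.

Lemma submodule_valD (x y : submodule_type) : val (x + y) = val x + val y.
Proof. exact: raddfD. Qed.

Lemma submodule_valZ a (x : submodule_type) : val (a *: x) = a *: val x.
Proof. exact: linearZ. Qed.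

Lemma submodule_val0 : val (0 : submodule_type) = 0.
Proof. exact: raddf0. Qed.

(** The left inverse of [val] that is [0] outside [A]. *)
Definition submodule_in (x : V) : submodule_type := insubd 0 x.

Lemma submodule_inK x : A x -> val (submodule_in x) = x.
Proof. by move=> Ax; rewrite /submodule_in insubdK // unfold_in /P /submodule_pred inE. Qed.

Lemma submodule_valK (x : submodule_type) : submodule_in (val x) = x.
Proof. exact: valKd. Qed.

Lemma submodule_in_linear : linear_on A submodule_in.
Proof.
move=> a x y Ax Ay; apply: val_inj.
rewrite submodule_valD submodule_valZ !submodule_inK //.
exact: hA.2.
Qed.

End SubmoduleType.

(** * Gluing two normed spaces along an almost isometry *)

(** Norms on a bare module. *)
Record norm_on (K : numFieldType) (M : lmodType K) := NormOn {
  norm_on_fun :> M -> K;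
  norm_onD : forall x y, norm_on_fun (x + y) <= norm_on_fun x + norm_on_fun y;
  norm_onZ : forall a x, norm_on_fun (a *: x) = `|a| * norm_on_fun x;
  norm_on0_eq0 : forall x, norm_on_fun x = 0 -> x = 0 }.

(** A copy of [M] normed by [N]; a copy is needed because [M] may already carry
    another norm, as a product of normed spaces does. *)
Definition renormed (K : numFieldType) (M : lmodType K) of norm_on M : Type := M.

Section Renormed.
Variables (K : numFieldType) (M : lmodType K) (N : norm_on M).
HB.instance Definition _ := GRing.Lmodule.copy (renormed N) M.
HB.instance Definition _ := Lmodule_isNormed.Build K (renormed N)
  (@norm_onD _ _ N) (@norm_onZ _ _ N) (@norm_on0_eq0 _ _ N).

Lemma renormed_normE (x : renormed N) : `|x| = N x.
Proof. by []. Qed.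
End Renormed.

Section Gluing.
Variables (K : numFieldType) (hK : order_complete K) (V W : normedModType K).
Variables (A : set V) (f : V -> W) (e : K).
Hypotheses (sA : submodule A) (fL : linear_on A f) (e0 : 0 < e).
Hypothesis fle : forall x, A x -> `|f x| <= (1 + e) * `|x|.

(** The cost of writing [(x, y)] as [(x - w, 0) + (0, y + f w) + (w, - f w)],
    where the last term is charged [e * `|w|]. *)
Definition glue_cost (x : V) (y : W) (w : V) : K :=
  `|x - w| + `|y + f w| + e * `|w|.

(** The infimum of the cost over [w] in [A]; the default value [0] of [xget] is
    never used, by [glue_norm_glb]. *)
Definition glue_norm (x : V) (y : W) : K :=
  xget 0 [set m | infimums [set glue_cost x y w | w in A] m].

Lemma glue_cost_ge0 x y w : 0 <= glue_cost x y w.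
Proof. by rewrite !addr_ge0 // mulr_ge0 // ltW. Qed.

Lemma glue_norm_glb x y : infimums [set glue_cost x y w | w in A] (glue_norm x y).
Proof.
rewrite /glue_norm; case: xgetP => [m _ //|no].
have [||m mglb] := hK (A := [set glue_cost x y w | w in A]).
- by exists (glue_cost x y 0), 0 => //; exact: submodule0.
- by move=> _ [w _ <-]; exact: glue_cost_ge0.
by have := no m.
Qed.

Lemma glue_norm_le x y w : A w -> glue_norm x y <= glue_cost x y w.
Proof. by move=> Aw; apply: (glue_norm_glb x y).1; exists w. Qed.

Lemma le_glue_norm x y l :
  (forall w, A w -> l <= glue_cost x y w) -> l <= glue_norm x y.
Proof. by move=> h; apply: (glue_norm_glb x y).2 => _ [w Aw <-]; exact: h. Qed.

Lemma glue_norm_ge0 x y : 0 <= glue_norm x y.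
Proof. by apply: le_glue_norm => w _; exact: glue_cost_ge0. Qed.

Lemma glue_normD x1 y1 x2 y2 :
  glue_norm (x1 + x2) (y1 + y2) <= glue_norm x1 y1 + glue_norm x2 y2.
Proof.
rewrite -lerBlDr; apply: le_glue_norm => w1 Aw1.
rewrite lerBlDr -lerBlDl; apply: le_glue_norm => w2 Aw2.
rewrite lerBlDl (le_trans (glue_norm_le _ _ (submoduleD sA Aw1 Aw2))) //.
rewrite /glue_cost (linear_onD fL) //.
have -> : `|x1 - w1| + `|y1 + f w1| + e * `|w1| + (`|x2 - w2| + `|y2 + f w2| + e * `|w2|)
  = `|x1 - w1| + `|x2 - w2| + (`|y1 + f w1| + `|y2 + f w2|) + e * (`|w1| + `|w2|).
  by ring.
apply: lerD; last by rewrite ler_pM2l // ler_normD.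
by apply: lerD; rewrite ?opprD addrACA ler_normD.
Qed.

Lemma glue_norm00 : glue_norm 0 0 = 0.
Proof.
apply/le_anti; rewrite glue_norm_ge0 andbT.
rewrite (le_trans (glue_norm_le _ _ (submodule0 sA))) //.
by rewrite /glue_cost (linear_on0 sA fL) subrr addr0 !normr0 mulr0 !addr0.
Qed.

Lemma glue_normZ_le a x y : glue_norm (a *: x) (a *: y) <= `|a| * glue_norm x y.
Proof.
have [->|a0] := eqVneq a 0; first by rewrite !scale0r glue_norm00 normr0 mul0r.
rewrite mulrC -ler_pdivrMr ?normr_gt0 //; apply: le_glue_norm => w Aw.
rewrite ler_pdivrMr ?normr_gt0 // mulrC.
rewrite (le_trans (glue_norm_le _ _ (submoduleZ sA a Aw))) // /glue_cost.
rewrite (linear_onZ sA fL) // -scalerBr -scalerDr !normrZ.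
by rewrite le_eqVlt; apply/orP; left; apply/eqP; ring.
Qed.

Lemma glue_normZ a x y : glue_norm (a *: x) (a *: y) = `|a| * glue_norm x y.
Proof.
apply/le_anti; rewrite glue_normZ_le /=.
have [->|a0] := eqVneq a 0; first by rewrite normr0 mul0r glue_norm_ge0.
have := glue_normZ_le a^-1 (a *: x) (a *: y).
by rewrite !scalerA mulVf // !scale1r normfV mulrC ler_pdivlMr ?normr_gt0 // mulrC.
Qed.

(** Definiteness needs [0 < e]: a small cost forces [w] to be small, hence
    also [x] and [y]. *)
Lemma glue_norm_definite x y : glue_norm x y = 0 -> x = 0 /\ y = 0.
Proof.
move=> N0.
have small d : 0 < d -> exists w, [/\ A w, `|x - w| <= d, `|y + f w| <= d & `|w| <= d / e].
  move=> d0; have [|_ [w Aw <-] cw] := glb_approx (glue_norm_glb x y) _ d0.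
    by move=> _ [w _ <-]; exact: glue_cost_ge0.
  rewrite N0 add0r in cw; exists w; split=> //; last rewrite ler_pdivlMr // mulrC.
  - apply: le_trans (ltW cw); rewrite /glue_cost -addrA lerDl addr_ge0 //.
    by rewrite mulr_ge0 // ltW.
  - apply: le_trans (ltW cw); rewrite /glue_cost addrAC lerDr addr_ge0 //.
    by rewrite mulr_ge0 // ltW.
  - by apply: le_trans (ltW cw); rewrite /glue_cost lerDr addr_ge0.
have e10 : 0 < 1 + (1 + e) / e by rewrite ltr_wpDr // divr_ge0 // ltW // addr_gt0.
have e11 : 0 < 1 + e^-1 by rewrite addr_gt0 // invr_gt0.
split; apply/normr0_eq0/le_anti; rewrite normr_ge0 andbT.
  apply: (le_of_small (c := 1 + e^-1)) => // d /small[w [_ xw _ wd]].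
  rewrite add0r -[x](subrK w) (le_trans (ler_normD _ _)) //.
  by rewrite mulrDl mul1r lerD // mulrC.
apply: (le_of_small (c := 1 + (1 + e) / e)) => // d /small[w [Aw _ yw wd]].
rewrite add0r -[y](addrK (f w)) (le_trans (ler_normB _ _)) //.
rewrite mulrDl mul1r lerD // (le_trans (fle Aw)) //.
by rewrite -mulrA ler_pM2l ?addr_gt0 // mulrC.
Qed.

Hypothesis fge : forall x, A x -> (1 - e) * `|x| <= `|f x|.

Lemma glue_norm_inl x : glue_norm x 0 = `|x|.
Proof.
apply/le_anti/andP; split.
  rewrite (le_trans (glue_norm_le _ _ (submodule0 sA))) // /glue_cost.
  by rewrite (linear_on0 sA fL) subr0 addr0 !normr0 mulr0 !addr0.
apply: le_glue_norm => w Aw; rewrite /glue_cost add0r -addrA.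
rewrite -{1}[x](subrK w) (le_trans (ler_normD _ _)) // lerD2l -lerBlDr.
by apply: le_trans (fge Aw); rewrite mulrBl mul1r.
Qed.

Lemma glue_norm_inr y : glue_norm 0 y = `|y|.
Proof.
apply/le_anti/andP; split.
  rewrite (le_trans (glue_norm_le _ _ (submodule0 sA))) // /glue_cost.
  by rewrite (linear_on0 sA fL) subr0 addr0 !normr0 mulr0 !addr0 add0r.
apply: le_glue_norm => w Aw; rewrite /glue_cost add0r normrN addrAC addrC.
rewrite -{1}[y](addrK (f w)) (le_trans (ler_normB _ _)) // lerD2l.
by apply: le_trans (fle Aw) _; rewrite mulrDl mul1r.
Qed.

Lemma glue_norm_graph x : A x -> glue_norm x (- f x) <= e * `|x|.
Proof.
move=> Ax; rewrite (le_trans (glue_norm_le _ _ Ax)) // /glue_cost.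
by rewrite subrr addNr !normr0 !add0r.
Qed.

(** The map induced by [P] and [Q] is non-expansive when [Q \o f] is [e]-close
    to [P]. *)
Lemma glue_norm_map (S : normedModType K) (P : {linear V -> S}) (Q : {linear W -> S}) x y :
  (forall u, `|P u| <= `|u|) -> (forall v, `|Q v| <= `|v|) ->
  (forall u, A u -> `|Q (f u) - P u| <= e * `|u|) ->
  `|P x + Q y| <= glue_norm x y.
Proof.
move=> Ple Qle PQ; apply: le_glue_norm => w Aw.
have -> : P x + Q y = P (x - w) + Q (y + f w) - (Q (f w) - P w).
  by rewrite linearB linearD addrACA [- P w + _]addrC addrK.
rewrite (le_trans (ler_normB _ _)) // lerD ?PQ //.
by rewrite (le_trans (ler_normD _ _)) // lerD.
Qed.

End Gluing.

(** * Approximate inverses from the left-Gurarii property *)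
Section Step.
Variables (K : numFieldType) (hK : order_complete K) (V S : normedModType K).
Variables (P : {linear V -> S}) (Ple : forall x, `|P x| <= `|x|).

(** [f] is on [A] a linear [e]-embedding that commutes with [P] up to [e]. Its
    values outside [A] are irrelevant. *)
Definition approx_iso (A : set V) (f : V -> V) (e : K) : Prop :=
  [/\ linear_on A f,
      (forall x, A x -> (1 - e) * `|x| <= `|f x|),
      (forall x, A x -> `|f x| <= (1 + e) * `|x|)
    & (forall x, A x -> `|P (f x) - P x| <= e * `|x|)].

(** The error of [g] as a left inverse of [f] depends on [e], but [g] is an
    approximate isometry to any prescribed precision [d]. *)
Lemma approx_iso_inverse (A B : set V) (f : V -> V) (e d : K) :
  left_gurarii P -> findim_subspace A -> findim_subspace B ->
  (forall x, A x -> B (f x)) -> approx_iso A f e -> 0 < e -> 0 < d ->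
  exists2 g, approx_iso B g d &
    forall x, A x -> `|g (f x) - x| <= ((1 + d) * e + d) * `|x|.
Proof.
move=> PlG fA fB fAB [fL fge fle fP] e0 d0.
have sA := findim_submodule fA; have sB := findim_submodule fB.
pose M : lmodType K := (submodule_type sA * submodule_type sB)%type.
pose NF (z : M) := glue_norm A f e (val z.1) (val z.2).
have ND z1 z2 : NF (z1 + z2) <= NF z1 + NF z2.
  by rewrite /NF !submodule_valD; exact: glue_normD.
have NZ a z : NF (a *: z) = `|a| * NF z.
  by rewrite /NF !submodule_valZ; exact: glue_normZ.
have N0 z : NF z = 0 -> z = 0.
  case: z => x y /(glue_norm_definite hK sA e0 fle)[/= x0 y0].
  by congr (_, _); apply: val_inj.
pose N := NormOn ND NZ N0; pose Z : normedModType K := renormed N.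
pose il (x : V) : Z := (submodule_in sA x, 0).
pose ir (y : V) : Z := (0, submodule_in sB y).
have lin0 (U : lmodType K) a : (0 : U) = a *: 0 + 0 by rewrite scaler0 addr0.
have ilL : linear_on A il.
  move=> a x y Ax Ay; rewrite /il submodule_in_linear //.
  exact: (congr2 pair (erefl _) (lin0 _ a)).
have irL : linear_on B ir.
  move=> a x y Bx By; rewrite /ir submodule_in_linear //.
  exact: (congr2 pair (lin0 _ a) (erefl _)).
have NE x y : A x -> B y -> `|il x + ir y| = glue_norm A f e x y.
  move=> Ax By; rewrite renormed_normE /NF; congr (glue_norm _ _ _ _ _).
    by rewrite submodule_valD submodule_inK // [X in _ + X]submodule_val0 addr0.
  by rewrite submodule_valD [X in X + _]submodule_val0 submodule_inK // add0r.
have ir0 : ir 0 = 0 by exact: (linear_on0 sB irL).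
have il0 : il 0 = 0 by exact: (linear_on0 sA ilL).
have il_norm x : A x -> `|il x| = `|x|.
  move=> Ax; have := NE x 0 Ax (submodule0 sB).
  by rewrite ir0 addr0 => ->; exact: glue_norm_inl.
have ir_norm y : B y -> `|ir y| = `|y|.
  move=> By; have := NE 0 y (submodule0 sA) By.
  by rewrite il0 add0r => ->; exact: glue_norm_inr.
have fZ : findim_subspace [set: Z].
  have -> : [set: Z] = [set x + y | x in il @` A & y in ir @` B].
    apply/seteqP; split=> // -[x y] _; exists (il (val x)).
      by exists (val x) => //; exact: submodule_valP.
    exists (ir (val y)); first by exists (val y) => //; exact: submodule_valP.
    rewrite /il /ir !submodule_valK.
    exact: (congr2 pair (addr0 x) (add0r y)).
  by apply: findim_add; apply: findim_image.
(* The extension problem: [T] is the operator on the glued space, [e0'] the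
   inclusion of its first summand into [V]. *)
pose T0 (z : Z) : S := P (val z.1) + P (val z.2).
have T0L : linear T0.
  move=> a x y; rewrite /T0 !submodule_valD !submodule_valZ !linearP.
  by rewrite scalerDr addrACA.
pose T : {linear Z -> S} := HB.pack T0 (GRing.isLinear.Build K Z S _ T0 T0L).
have Tle z : `|T z| <= `|z|.
  by rewrite renormed_normE; exact: glue_norm_map.
pose e0' (z : Z) : V := val z.1.
have [|||F [Femb Fe FT]] := PlG Z (il @` A) T e0' d fZ (findim_image fA ilL) _ _ _ d0.
- by apply: opnorm_le => // z _; rewrite mul1r.
- split=> [a _ _ [x Ax <-] [y Ay <-]|_ [x Ax <-]].
    by rewrite /e0' !submodule_valD submodule_valZ.
  by rewrite il_norm // /e0' submodule_inK.
- by move=> _ [x Ax <-]; rewrite /= /T0 /e0' [X in _ + P X]submodule_val0 linear0 addr0.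
have ZA a z : (il @` A) z -> (il @` A) (a *: z).
  by move=> [x Ax <-]; exists (a *: x); [exact: submoduleZ|exact: (linear_onZ sA ilL)].
have {}Fe x : A x -> `|F (il x) - x| <= d * `|x|.
  move=> Ax; rewrite -(il_norm x Ax) -[X in _ - X](submodule_inK sA Ax).
  apply: (le_opnorm hK _ Fe); last by exists x.
  move=> a z Az; split; first exact: ZA.
  by rewrite linearZ /e0' submodule_valZ scalerBr.
have {}FT z : `|P (F z) - T z| <= d * `|z|.
  apply: (le_opnorm hK _ FT) => // a w _; split=> //.
  by rewrite !linearZ_LR -scalerDr.
have d1 : 0 <= 1 + d by rewrite ltW // addr_gt0.
(* [g (f x) - x] is [F (il x) - x], which is small by the choice of [F], minus
   the image by [F] of [il x - ir (f x)], an element of norm at most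
   [e * `|x|]. *)
exists (F \o ir); last first.
  move=> x Ax; rewrite -[X in `|X|](subrKA (F (il x))).
  rewrite (le_trans (ler_normD _ _)) // mulrDl lerD ?Fe //= -linearB.
  rewrite (le_trans (Femb _).2) // -mulrA ler_wpM2l //.
  have Bfx : B (- f x) by rewrite -scaleN1r; apply: submoduleZ => //; exact: fAB.
  have irN : ir (f x) = - ir (- f x).
    by rewrite -[f x in LHS]opprK -[- - f x]scaleN1r (linear_onZ sB irL) // scaleN1r.
  rewrite irN -opprD normrN addrC NE //.
  exact: glue_norm_graph.
split=> [a x y Bx By|y By|y By|y By] /=.
- by rewrite irL // linearP.
- by rewrite -(ir_norm y By); exact: (Femb _).1.
- by rewrite -(ir_norm y By); exact: (Femb _).2.
- rewrite -(ir_norm y By); have := FT (ir y).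
  have -> : T (ir y) = P y; last by [].
  by rewrite /= /T0 [X in P X + _]submodule_val0 linear0 add0r submodule_inK.
Qed.
End Step.

(** * The back-and-forth sequence *)
Section BackAndForth.
Variables (K : numFieldType) (hK : order_complete K) (V S : normedModType K).
Variables (P : {linear V -> S}) (Ple : forall x, `|P x| <= `|x|).
Hypothesis PlG : left_gurarii P.

(** [A n.+1] contains the range of [f n] and the point [d n./2]. Halving the
    index makes every term of [d] appear in a subspace of even index and in one
    of odd index. *)
Lemma back_and_forth (d : nat -> V) (X0 X1 : set V) (h : V -> V) (e : K) :
  findim_subspace X0 -> findim_subspace X1 -> (forall x, X0 x -> X1 (h x)) ->
  0 < e -> e <= 1 -> approx_iso P X0 h e ->
  exists (A : nat -> set V) (f : nat -> V -> V),
    [/\ A 0%N = X0 /\ f 0%N = h,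
        forall n, submodule (A n) /\ A n `<=` A n.+2,
        forall n, approx_iso P (A n) (f n) (e / 2 ^+ n),
        forall n, A n.+1 (d n./2)
      & forall n x, A n x -> A n.+1 (f n x) /\
          `|f n.+1 (f n x) - x| <= 3 * (e / 2 ^+ n) * `|x| ].
Proof.
move=> fX0 fX1 hX e0 e1 hh.
pose eps n : K := e / 2 ^+ n.
have eps0 n : 0 < eps n by rewrite divr_gt0 // exprn_gt0 // ltr0n.
have epsS n : eps n.+1 <= eps n.
  by rewrite /eps ler_pM2l // lef_pV2 ?posrE ?exprn_gt0 ?ltr0n // ler_weXn2l // ler1n.
have eps1 n : eps n <= 1 by elim: n => [|n /(le_trans (epsS n))//]; rewrite /eps expr0 divr1.
(* A state is a triple [(A, B, f)] with [f] from [A] to [B]; the next one is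
   [(A', g A' + A, g)], with [A'] spanned by [B] and a new point and [g] an
   approximate left inverse of [f]. *)
pose st := (set V * set V * (V -> V))%type.
pose inv n (s : st) := [/\ findim_subspace s.1.1, findim_subspace s.1.2,
  forall x, s.1.1 x -> s.1.2 (s.2 x) & approx_iso P s.1.1 s.2 (eps n)].
pose rel n (s t : st) := [/\ s.1.2 `<=` t.1.1, t.1.1 (d n./2), s.1.1 `<=` t.1.2 &
  forall x, s.1.1 x -> `|t.2 (s.2 x) - x| <= 3 * eps n * `|x|].
have step (p : nat * st) : exists t, inv p.1 p.2 -> inv p.1.+1 t /\ rel p.1 p.2 t.
  case: p => n [[A B] f] /=.
  have [[/= fA fB fAB fe]|ninv] := pselect (inv n (A, B, f)); last by exists (A, B, f).
  pose A' := [set x + y | x in B & y in range (fun c : K => c *: d n./2)].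
  have fA' : findim_subspace A' by apply: findim_add => //; exact: findim_line.
  have BA' : B `<=` A'.
    by move=> x Bx; exists x => //; exists 0; [exists 0 => //; rewrite scale0r|rewrite addr0].
  have [|g gA' gf] := approx_iso_inverse hK Ple PlG fA fA' _ fe (eps0 n) (eps0 n.+1).
    by move=> x /fAB /BA'.
  exists (A', [set x + y | x in g @` A' & y in A], g) => _.
  have sA := findim_submodule fA; have sA' := findim_submodule fA'.
  have gL : linear_on A' g by case: gA'.
  split; split=> //=.
  - by apply: findim_add => //; exact: findim_image.
  - move=> x A'x; exists (g x); first by exists x.
    by exists 0; [exact: submodule0|rewrite addr0].
  - exists 0; first exact: submodule0 (findim_submodule fB).
    by exists (d n./2); [exists 1 => //; rewrite scale1r|rewrite add0r].
  - move=> x Ax; exists 0; last by exists x => //; rewrite add0r.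
    by exists 0; [exact: submodule0|exact: (linear_on0 sA' gL)].
  - move=> x Ax; apply: le_trans (gf _ Ax) _; rewrite ler_wpM2r //.
    have -> : 3 * eps n = (1 + 1) * eps n + eps n by ring.
    by rewrite lerD // ler_pM2r // lerD2l.
have [F HF] := choice step.
pose s := fix s n : st := if n is m.+1 then F (m, s m) else (X0, X1, h).
have sinv n : inv n (s n).
  elim: n => [|n /(HF (n, s n))[] //].
  by split=> //=; rewrite /eps expr0 divr1.
have srel n : rel n (s n) (s n.+1) by have [] := HF (n, s n) (sinv n).
exists (fun n => (s n).1.1), (fun n => (s n).2); split=> //.
- move=> n; split; first by apply: findim_submodule; case: (sinv n).
  by apply: (@subset_trans _ (s n.+1).1.2); [case: (srel n)|case: (srel n.+1)].
- by move=> n; case: (sinv n).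
- by move=> n; case: (srel n).
- move=> n x Ax; have [rB _ _ rf] := srel n; split; last exact: rf.
  by apply: rB; case: (sinv n) => _ _ + _; apply.
Qed.

End BackAndForth.

(** * Complete spaces *)
Section Completeness.
Variables (K : numFieldType) (hK : order_complete K) (V : completeNormedModType K).

Lemma cauchy_sequence_converges (u : nat -> V) :
  (forall d : K, 0 < d -> exists N, forall m n, (N <= m)%N -> (N <= n)%N ->
     `|u m - u n| < d) ->
  exists l, forall d : K, 0 < d -> exists N, forall n, (N <= n)%N -> `|l - u n| < d.
Proof.
move=> hu.
have cu : cauchy (u @ \oo).
  apply/cauchyP => d d0; have [N HN] := hu d d0.
  exists (u N); exists N => // n /= Nn; rewrite -ball_normE /ball_ /=.
  by apply: HN.
have /cvg_ex[/= l ul] : cvg (u @ \oo) by exact: cauchy_cvg.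
exists l => d d0; have /cvgrPdist_lt/(_ d d0)[N _ HN] := ul.
by exists N => n Nn; exact: HN.
Qed.

Lemma isometry_dense_range_surj (H : {linear V -> V}) :
  (forall x, `|H x| = `|x|) ->
  (forall y (d : K), 0 < d -> exists x, `|H x - y| < d) ->
  forall y, exists x, H x = y.
Proof.
move=> Hiso Hd y.
have p0 n : 0 < 1 / 2 ^+ n :> K by rewrite divr_gt0 // exprn_gt0 // ltr0n.
have [u Hu] := choice (fun n => Hd y _ (p0 n)).
have small d : 0 < d -> exists N, forall n, (N <= n)%N -> `|H (u n) - y| < d.
  move=> d0; have [N HN] := geometric_small hK ltr01 d0.
  by exists N => n /HN; exact: lt_trans.
have [|x Hx] := @cauchy_sequence_converges u.
  move=> d d0; have [|N HN] := small (d / 2); first by rewrite divr_gt0 // ltr0n.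
  exists N => m n Nm Nn; rewrite -Hiso linearB -[X in `|X|](subrKA y).
  by rewrite (le_lt_trans (ler_normD _ _)) // [d]splitr ltrD ?HN // distrC HN.
exists x; apply/eqP; rewrite -subr_eq0 -normr_le0.
apply: (le_of_small (c := 2)) => // d d0.
have [N1 H1] := small d d0; have [N2 H2] := Hx d d0.
rewrite add0r -[X in `|X|](subrKA (H (u (maxn N1 N2)))).
rewrite (le_trans (ler_normD _ _)) // mulr_natl mulr2n lerD //.
  by rewrite -linearB Hiso ltW // H2 // leq_maxr.
by rewrite ltW // H1 // leq_maxl.
Qed.

End Completeness.

(** * Limits of almost isometries *)
Section Limit.
Variables (K : numFieldType) (hK : order_complete K).
Variables (V : completeNormedModType K) (S : normedModType K).
Variables (P : {linear V -> S}) (Ple : forall x, `|P x| <= `|x|).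
Variables (E : nat -> set V) (F : nat -> V -> V) (eta : nat -> K).
(** [F n] is an [eta n]-isometry on the increasing subspaces [E n], whose union
    is dense; successive maps are close, and the values of the [F n] come close
    to every point. *)
Hypothesis sE : forall n, submodule (E n).
Hypothesis ES : forall n, E n `<=` E n.+1.
Hypothesis Fiso : forall n, approx_iso P (E n) (F n) (eta n).
Hypothesis eta0 : forall n, 0 < eta n.
Hypothesis eta1 : forall n, eta n <= 1.
Hypothesis etaS : forall n, eta n.+1 *+ 2 <= eta n.
Hypothesis eta_small : forall d, 0 < d -> exists N, forall n, (N <= n)%N -> eta n < d.
Hypothesis E_dense : forall x (d : K), 0 < d ->
  exists N, forall n, (N <= n)%N -> exists2 a, E n a & `|x - a| < d.
Hypothesis F_step : forall n x, E n x -> `|F n.+1 x - F n x| <= 12 * eta n * `|x|.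
Hypothesis F_dense : forall y (d : K), 0 < d ->
  exists n a, [/\ E n a, `|F n a - y| <= d & eta n * `|a| <= d].

Lemma E_mono m n : (m <= n)%N -> E m `<=` E n.
Proof.
move=> /subnK <-; elim: (n - m)%N => // k IH; rewrite addSn.
exact: subset_trans (@ES _).
Qed.

Lemma F_le2 n x : E n x -> `|F n x| <= 2 * `|x|.
Proof.
case: (Fiso n) => _ _ le _ /le /le_trans; apply.
by rewrite ler_wpM2r // lerD2l.
Qed.

(** The sum of the steps [12 * eta k] for [k >= m] is at most [24 * eta m], as
    [eta] is at least halved each time. *)
Lemma F_cauchy m n x : (m <= n)%N -> E m x ->
  `|F n x - F m x| <= 24 * eta m * `|x|.
Proof.
move=> mn Ex.
(* The sharper bound telescopes. *)
suff : `|F n x - F m x| <= 24 * (eta m - eta n) * `|x|.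
  move=> /le_trans; apply; rewrite ler_wpM2r // ler_wpM2l ?ler0n //.
  by rewrite gerBl ltW.
move: mn => /subnK <-; elim: (n - m)%N => [|k IH].
  by rewrite !add0n !subrr normr0 mulr0 mul0r.
rewrite addSn -[X in `|X|](subrKA (F (k + m)%N x)) (le_trans (ler_normD _ _)) //.
have -> : 24 * (eta m - eta (k + m).+1) * `|x| =
  24 * (eta (k + m)%N - eta (k + m).+1) * `|x| + 24 * (eta m - eta (k + m)%N) * `|x|.
  by ring.
apply: lerD IH; apply: le_trans (F_step (E_mono (leq_addl _ _) Ex)) _.
rewrite ler_wpM2r //.
have -> : 24 * (eta (k + m)%N - eta (k + m).+1) =
  12 * eta (k + m)%N + 12 * (eta (k + m)%N - eta (k + m).+1 *+ 2) by ring.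
by rewrite lerDl mulr_ge0 ?ler0n // subr_ge0.
Qed.

Lemma F_diff m n a b : (m <= n)%N -> E m a -> E n b ->
  `|F n b - F m a| <= 2 * `|b - a| + 24 * eta m * `|a|.
Proof.
move=> mn Ea Eb; rewrite -[X in `|X|](subrKA (F n a)).
have Ena : E n a by exact: (E_mono mn).
rewrite (le_trans (ler_normD _ _)) // lerD ?F_cauchy //.
have [FL _ _ _] := Fiso n.
by rewrite -(linear_onB FL) // F_le2 //; exact: submoduleB.
Qed.

(** The limit is characterized by an estimate valid at every stage, with no
    reference to the approximating sequence used to construct it. *)
Lemma limit_exists x :
  exists y, forall n a, E n a -> `|y - F n a| <= 2 * `|x - a| + 24 * eta n * `|a|.
Proof.
have p0 n : 0 < 1 / 2 ^+ n :> K by rewrite divr_gt0 // exprn_gt0 // ltr0n.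
have /choice[s Hs] : forall k : nat, exists p : nat * V,
    [/\ (k <= p.1)%N, E p.1 p.2 & `|x - p.2| < 1 / 2 ^+ k].
  move=> k; have [N HN] := E_dense x (p0 k).
  have [a Ea ax] := HN (maxn k N) (leq_maxr _ _).
  by exists (maxn k N, a); split=> //=; exact: leq_maxl.
have small d : 0 < d -> exists N, forall k, (N <= k)%N -> `|x - (s k).2| < d.
  move=> d0; have [N HN] := geometric_small hK ltr01 d0.
  by exists N => n /HN; apply: lt_trans; case: (Hs n).
have [|y Hy] := @cauchy_sequence_converges _ _ (fun k => F (s k).1 (s k).2).
  move=> d d0.
  pose c := 4 + 24 * (`|x| + 1).
  have c0 : 0 < c by rewrite addr_gt0 ?ltr0n // mulr_gt0 ?ltr0n // ltr_wpDl.
  have dc0 : 0 < d / c by rewrite divr_gt0.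
  have [N1 H1] := small _ dc0; have [N2 H2] := eta_small dc0.
  have [N3 H3] := small _ ltr01.
  exists (maxn N1 (maxn N2 N3)) => m n.
  rewrite !geq_max => /and3P[m1 m2 m3] /and3P[n1 n2 n3].
  wlog mn : m n m1 m2 m3 n1 n2 n3 / ((s m).1 <= (s n).1)%N.
    move=> wl; have [/wl|/ltnW/wl] := leqP (s m).1 (s n).1; first exact.
    by rewrite distrC; apply.
  have [sm Em am] := Hs m; have [sn En an] := Hs n.
  rewrite distrC; apply: le_lt_trans (F_diff mn Em En) _.
  have -> : d = 4 * (d / c) + (d / c) * (24 * (`|x| + 1)).
    by rewrite {1}/c /c; field; rewrite gt_eqF.
  apply: ltr_leD.
    have -> : 4 * (d / c) = 2 * (d / c + d / c) by ring.
    rewrite ltr_pM2l ?ltr0n // -[X in `|X|](subrKA x).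
    by rewrite (le_lt_trans (ler_normD _ _)) // ltrD // ?H1 // distrC H1.
  rewrite mulrAC mulrC; apply: ler_pM => //.
  - by rewrite ltW.
  - by rewrite ltW // H2 // (leq_trans m2).
  rewrite ler_pM2l ?ltr0n // -{1}[(s m).2](subrK x) addrC.
  by rewrite (le_trans (ler_normD _ _)) // lerD2l distrC ltW // H3.
exists y => n a Ea; apply: (le_of_small (c := 3)); rewrite ?ltr0n //.
- by rewrite ger0_real // addr_ge0 // mulr_ge0 ?ler0n // mulr_ge0 ?ler0n // ltW.
move=> d d0; have [N1 H1] := small _ d0; have [N2 H2] := Hy _ d0.
pose k := maxn n (maxn N1 N2).
have [k1 k2 k3] : [/\ (n <= k)%N, (N1 <= k)%N & (N2 <= k)%N].
  by apply/and3P; rewrite -!geq_max.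
have [sk Ek ak] := Hs k.
rewrite -[X in `|X|](subrKA (F (s k).1 (s k).2)) (le_trans (ler_normD _ _)) //.
have -> : 2 * `|x - a| + 24 * eta n * `|a| + 3 * d =
  d + (2 * (d + `|x - a|) + 24 * eta n * `|a|) by ring.
apply: lerD; first by rewrite ltW // H2.
apply: le_trans (F_diff (leq_trans k1 sk) Ea Ek) _.
rewrite lerD2r ler_pM2l ?ltr0n // -[X in `|X|](subrKA x).
by rewrite (le_trans (ler_normD _ _)) // lerD2r distrC ltW // H1.
Qed.

Lemma dist_triangle (U : normedModType K) (u v w : U) (a b : K) :
  `|u - v| <= a -> `|v - w| <= b -> `|u - w| <= a + b.
Proof.
by move=> ua vb; rewrite -[u - w](subrKA v) (le_trans (ler_normD _ _)) // lerD.
Qed.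

Lemma dist_linear_comb (c d : K) (x y q r : V) :
  `|x - q| <= d -> `|y - r| <= d ->
  `|(c *: x + y) - (c *: q + r)| <= (`|c| + 1) * d.
Proof.
move=> xq yr; rewrite opprD addrACA -scalerBr (le_trans (ler_normD _ _)) //.
by rewrite normrZ mulrDl mul1r lerD // ler_wpM2l.
Qed.

(** Given [x], all late stages contain a point close to [x] whose image is
    close to [H x]. The bound on [eta n * `|a|] makes the defects of [F n] at
    [a] small too. *)
Lemma limit_approx (H : V -> V) :
  (forall x n a, E n a -> `|H x - F n a| <= 2 * `|x - a| + 24 * eta n * `|a|) ->
  forall x (d : K), 0 < d -> exists N, forall n, (N <= n)%N ->
    exists a, [/\ E n a, `|x - a| <= d, `|H x - F n a| <= d & eta n * `|a| <= d].
Proof.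
move=> HE x d d0.
have d40 : 0 < d / 4 by rewrite divr_gt0 // ltr0n.
have c0 : 0 < `|x| + d / 4 by rewrite ltr_wpDl.
have e0 : 0 < d / 48 / (`|x| + d / 4) by rewrite !divr_gt0 // ltr0n.
have [N1 H1] := E_dense x d40; have [N2 H2] := eta_small e0.
(* With [`|x - a| <= d / 4] and [eta n * `|a| <= d / 48], the estimate for
   [H x - F n a] adds up to [d / 2 + d / 2]. *)
exists (maxn N1 N2) => n; rewrite geq_max => /andP[n1 n2].
have [a Ea /ltW xa] := H1 n n1.
have ale : `|a| <= `|x| + d / 4.
  by rewrite -[a](subKr x) (le_trans (ler_normB _ _)) // lerD2l.
have ea : eta n * `|a| <= d / 48.
  rewrite (le_trans (ler_pM _ _ (ltW (H2 n n2)) ale)) ?(ltW (eta0 n)) //.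
  by rewrite divfK // gt_eqF.
have frac c : 1 <= c -> d / c <= d.
  by move=> c1; rewrite ler_pdivrMr ?(lt_le_trans ltr01) // ler_peMr // ltW.
exists a; split=> //.
- by apply: le_trans xa _; rewrite frac // ler1n.
- apply: le_trans (HE _ _ _ Ea) _; rewrite -mulrA.
  have -> : d = 2 * (d / 4) + 24 * (d / 48) by field.
  by apply: lerD; rewrite ler_pM2l ?ltr0n.
- by apply: le_trans ea _; rewrite frac // ler1n.
Qed.

Lemma limit_isometry : exists H : {linear V -> V},
  [/\ bijective H, forall x, `|H x| = `|x|, forall x, P (H x) = P x
    & forall x, E 0%N x -> `|H x - F 0%N x| <= 24 * eta 0%N * `|x|].
Proof.
have [H HE] := choice limit_exists.
have Happ := limit_approx HE.
have H_lin : linear H.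
  move=> c x y; apply/eqP; rewrite -subr_eq0 -normr_le0.
  apply: (le_of_small (c := 3 * (2 + `|c|))) => // d d0; rewrite add0r.
  have [N1 H1] := Happ (c *: x + y) d d0.
  have [N2 H2] := Happ x d d0; have [N3 H3] := Happ y d d0.
  pose n := maxn N1 (maxn N2 N3).
  have [n1 n2 n3] : [/\ (N1 <= n)%N, (N2 <= n)%N & (N3 <= n)%N].
    by apply/and3P; rewrite -!geq_max.
  have [p [Ep xp Hp _]] := H1 n n1.
  have [q [Eq xq Hq _]] := H2 n n2.
  have [r [Er xr Hr _]] := H3 n n3.
  have Ecqr : E n (c *: q + r) by exact: (sE n).2.
  have [FL _ _ _] := Fiso n.
  have pqr : `|p - (c *: q + r)| <= d + (`|c| + 1) * d.
    by apply: (dist_triangle (v := c *: x + y)); [rewrite distrC|exact: dist_linear_comb].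
  have Fpqr : `|F n p - (c *: F n q + F n r)| <= 2 * (d + (`|c| + 1) * d).
    rewrite -FL // -(linear_onB FL) //.
    by rewrite (le_trans (F_le2 _)) ?ler_pM2l ?ltr0n //; exact: submoduleB.
  have -> : 3 * (2 + `|c|) * d =
    d + (2 * (d + (`|c| + 1) * d) + (`|c| + 1) * d) by ring.
  apply: (dist_triangle Hp); apply: (dist_triangle Fpqr).
  by apply: dist_linear_comb; rewrite distrC.
pose HL : {linear V -> V} := HB.pack H (GRing.isLinear.Build K V V _ H H_lin).
have HLE x (d : K) : 0 < d -> exists n a,
    [/\ E n a, `|x - a| <= d, `|H x - F n a| <= d & eta n * `|a| <= d].
  by move=> /(Happ x)[N HN]; have [a Ha] := HN N (leqnn _); exists N, a.
have Hiso x : `|HL x| = `|x|.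
  apply/le_anti/andP; split; apply: (le_of_small (c := 3)); rewrite ?ltr0n // => d d0;
    have [n [a [Ea xa Ha ea]]] := HLE x d d0; have [_ Fge Fle _] := Fiso n.
    have -> : `|x| + 3 * d = d + (`|x| + d + d) by ring.
    rewrite -[HL x](subrK (F n a)) (le_trans (ler_normD _ _)) // lerD //.
    apply: le_trans (Fle _ Ea) _; rewrite mulrDl mul1r lerD //.
    by rewrite -[a](subKr x) (le_trans (ler_normB _ _)) // lerD2l.
  have -> : `|HL x| + 3 * d = d + (`|HL x| + d + d) by ring.
  rewrite -[x in `|x| <= _](subrK a) (le_trans (ler_normD _ _)) // lerD //.
  rewrite -lerBlDr; apply: le_trans (_ : `|F n a| <= _).
    by apply: le_trans (Fge _ Ea); rewrite mulrBl mul1r lerD2l lerN2.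
  by rewrite -[F n a](subKr (HL x)) (le_trans (ler_normB _ _)) // lerD2l.
exists HL; split=> //.
- have Hsurj : forall y, exists x, HL x = y.
    apply: (isometry_dense_range_surj hK) => // y d d0.
    (* [`|H a - y|] is at most [24 + 1] times the precision asked for. *)
    have d50 : 0 < d / 50 by rewrite divr_gt0 // ltr0n.
    have [n [a [Ea ay ea]]] := F_dense y d50.
    exists a; apply: le_lt_trans (_ : 25 * (d / 50) < d); last first.
      have -> : 25 * (d / 50) = d / 2 by field.
      by rewrite ltr_pdivrMr ?ltr0n // ltr_pMr // ltr1n.
    have -> : 25 * (d / 50) = 24 * (d / 50) + d / 50 by ring.
    apply: dist_triangle ay; apply: le_trans (HE _ _ _ Ea) _.
    by rewrite subrr normr0 mulr0 add0r -mulrA ler_pM2l ?ltr0n.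
  have [G GK] := choice Hsurj.
  exists G => // x; apply/eqP; rewrite -subr_eq0 -normr_eq0 -Hiso linearB.
  by rewrite (GK (HL x)) subrr normr0.
- move=> x; apply/eqP; rewrite -subr_eq0 -normr_le0.
  apply: (le_of_small (c := 3)) => // d d0; rewrite add0r.
  have [n [a [Ea xa Ha ea]]] := HLE x d d0; have [_ _ _ FP] := Fiso n.
  have -> : 3 * d = d + (d + d) by ring.
  apply: (dist_triangle (v := P (F n a))).
    by rewrite -linearB (le_trans (Ple _)).
  apply: (dist_triangle (v := P a)); first exact: le_trans (FP _ Ea) _.
  by rewrite -linearB (le_trans (Ple _)) // distrC.
- move=> x Ex; apply: le_trans (HE _ _ _ Ex) _.
  by rewrite subrr normr0 mulr0 add0r.
Qed.

End Limit.

(** * The global isometry *)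
Section Isometry.
Variables (K : numFieldType) (hK : order_complete K).
Variables (V : completeNormedModType K) (S : normedModType K).
Variables (P : {linear V -> S}) (Ple : forall x, `|P x| <= `|x|).

Lemma separable_dense_sequence : separable_space V ->
  exists s : nat -> V, forall x (d : K), 0 < d -> exists j, `|x - s j| < d.
Proof.
move=> [D /countable_injP[g ginj] Ddense].
exists (fun j => xget 0 [set y | D y /\ g y = j]) => x d d0.
have [] := Ddense (ball x d).
- by exists x; exact: ballxx.
- exact: ball_open.
move=> y; rewrite -ball_normE => -[xy Dy]; exists (g y).
case: xgetP => [z _ [Dz gz]|/(_ y)]; last by case.
by rewrite (ginj z y) ?inE.
Qed.

(** Almost isometries between finite-dimensional subspaces that almost commute
    with [P] are uniformly close to global isometries commuting with [P]. *)
Lemma approx_iso_isometry (X0 X1 : set V) (h : V -> V) (e : K) :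
  left_gurarii P -> separable_space V ->
  findim_subspace X0 -> findim_subspace X1 -> (forall x, X0 x -> X1 (h x)) ->
  0 < e -> e <= 1 -> approx_iso P X0 h e ->
  exists H : {linear V -> V},
    [/\ bijective H, forall x, `|H x| = `|x|, forall x, P (H x) = P x
      & forall x, X0 x -> `|H x - h x| <= 24 * e * `|x|].
Proof.
move=> PlG /separable_dense_sequence[s sd] fX0 fX1 hX e0 e1 hh.
have [A [f [[A0 f0] sA fA Ad Af]]] := back_and_forth hK Ple PlG s fX0 fX1 hX e0 e1 hh.
pose eps n : K := e / 2 ^+ n.
have eps0 n : 0 < eps n by rewrite divr_gt0 // exprn_gt0 // ltr0n.
have epsS n : eps n = eps n.+1 *+ 2.
  by rewrite /eps exprS -mulr_natr; field; rewrite expf_neq0 // pnatr_eq0.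
have epsS_le n : eps n.+1 <= eps n by rewrite [leRHS]epsS mulr2n lerDl ltW.
have eps1 n : eps n <= 1 by
  elim: n => [|n /(le_trans (epsS_le n))//]; rewrite /eps expr0 divr1.
have eps_small d : 0 < d -> exists N, forall n, (N <= n)%N -> eps n < d.
  exact: geometric_small.
have Amono m k : A m `<=` A (m + k.*2)%N.
  elim: k => [|k IH]; first by rewrite addn0.
  by rewrite doubleS !addnS; apply: subset_trans IH (sA _).2.
have f_le2 n x : A n x -> `|f n x| <= 2 * `|x|.
  case: (fA n) => _ _ le _ /le /le_trans; apply.
  by rewrite ler_wpM2r // lerD2l // eps1.
(* The limit is taken along the even indices. *)
have [||||||||||H [Hbij Hiso HP HX]] := @limit_isometry K hK V S P Ple
  (fun n => A n.*2) (fun n => f n.*2) (fun n => eps n.*2).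
- by move=> n; exact: (sA _).1.
- by move=> n; rewrite doubleS; exact: (sA _).2.
- by move=> n; exact: fA.
- by move=> n; exact: eps0.
- by move=> n; exact: eps1.
- by move=> n; rewrite doubleS -epsS.
- move=> d /eps_small[N HN]; exists N => n Nn; apply: HN.
  by rewrite (leq_trans Nn) // -addnn leq_addr.
- move=> x d /(sd x)[j xj]; exists j.+1 => n jn; exists (s j) => //.
  rewrite -(subnKC jn) doubleD; apply: Amono.
  by have := Ad j.*2.+1; rewrite /= uphalf_double doubleS.
(* Successive even maps differ by [12 * eps m]: [f m.+2 (f m.+1 (f m x))] is
   close both to [f m.+2 x] and to [f m x]. *)
- move=> n x; rewrite doubleS; set m := n.*2 => Ax.
  have [Au vx] := Af m x Ax; have [Av fvu] := Af m.+1 _ Au.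
  have [fL _ _ _] := fA m.+2.
  have -> : 12 * eps m * `|x| = 2 * (3 * eps m * `|x|) + 3 * eps m * (2 * `|x|) by ring.
  apply: (dist_triangle (v := f m.+2 (f m.+1 (f m x)))).
    rewrite -(linear_onB fL) //; last exact: (sA m).2.
    rewrite (le_trans (f_le2 _ _ _)) ?ler_pM2l ?ltr0n //; last by rewrite distrC.
    by apply: (submoduleB (sA m.+2).1) => //; exact: (sA m).2.
  apply: le_trans fvu _; rewrite -/(eps m.+1).
  apply: ler_pM; [|by []| |exact: f_le2].
    by rewrite mulr_ge0 ?ler0n // ltW // eps0.
  by rewrite ler_pM2l ?ltr0n // epsS_le.
(* A point [s j] close to [y] lies in a subspace of odd index [m], and
   [f m (s j)] is almost sent back to it by [f m.+1]. *)
- move=> y d d0; have [|j yj] := sd y (d / 2); first by rewrite divr_gt0 // ltr0n.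
  have c0 : 0 < 6 * (`|s j| + 1) by rewrite mulr_gt0 ?ltr0n // ltr_wpDl.
  have [N HN] := eps_small _ (divr_gt0 d0 c0).
  pose n := maxn N j; pose m := n.*2.+1.
  have em : eps m < d / (6 * (`|s j| + 1)).
    apply: HN; rewrite /m (leq_trans (leq_maxl N j)) // -/n.
    by rewrite -addnn (leq_trans (leq_addr n n)).
  have Aj : A m (s j).
    have -> : m = (j.*2.+1 + (n - j).*2)%N.
      by rewrite addSn -doubleD subnKC // leq_maxr.
    by apply: Amono; have := Ad j.*2; rewrite doubleK.
  have [Aa fa] := Af m _ Aj.
  have small : 6 * (eps m * `|s j|) <= d.
    have : eps m * (6 * (`|s j| + 1)) <= d by rewrite -ler_pdivlMr // ltW.
    apply: le_trans; rewrite mulrCA ler_pM2l // ler_pM2l ?ltr0n //.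
    by rewrite lerDl.
  exists n.+1, (f m (s j)); rewrite doubleS; split=> //.
    rewrite [d]splitr; apply: (dist_triangle (v := s j)); last by rewrite distrC ltW.
    apply: le_trans fa _; rewrite ler_pdivlMr ?ltr0n //; apply: le_trans small.
    by rewrite le_eqVlt; apply/orP; left; apply/eqP; rewrite -/(eps m); ring.
  apply: le_trans small; rewrite mulrCA; apply: ler_pM => //; first exact: ltW.
  apply: le_trans (f_le2 _ _ Aj) _.
  by rewrite ler_wpM2r // ler_nat.
exists H; split=> // x X0x; have := HX x.
by rewrite /= A0 f0 /eps expr0 divr1; exact.
Qed.

End Isometry.

Theorem theorem1p7 (R : realType) (K : numFieldType)
    (hK : real_or_complex R K)
    (S V : completeNormedModType K)
    (sepS : separable_space S) (sepV : separable_space V)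
    (P : {linear V -> S}) (P_nonexp : nonexpansive P) (P_lG : left_gurarii P)
    (X0 X1 : set V) (fX0 : findim_subspace X0) (fX1 : findim_subspace X1)
    (h : V -> V) (h_iso : linear_isometry_on X0 h)
    (h_maps : forall x, X0 x -> X1 (h x))
    (h_P : forall x, X0 x -> P (h x) = P x)
    (eps : K) (eps_gt0 : 0 < eps) :
  exists H : {linear V -> V},
    [/\ bijective H,
        (forall x, `|H x| = `|x|),
        (forall x, P (H x) = P x)
      & (opnorm X0 (fun x => H x - h x)%R < eps%:E)%E].
Proof.
have Kc := real_or_complex_order_complete hK.
have Ple x : `|P x| <= `|x|.
  rewrite -[leRHS]mul1r; apply: (le_opnorm Kc _ P_nonexp) => // a u _.
  by rewrite linearZ.
case: h_iso => hL hiso.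
(* This choice gives both [e <= 1] and [24 * e < eps]. *)
pose e := eps / (eps + 48).
have D0 : 0 < eps + 48 by rewrite addr_gt0 // ltr0n.
have e0 : 0 < e by rewrite divr_gt0.
have e1 : e <= 1 by rewrite ler_pdivrMr // mul1r lerDl ler0n.
have e24 : 24 * e < eps.
  rewrite /e mulrCA -ltr_pdivlMl // mulVf ?gt_eqF // ltr_pdivrMr // mul1r.
  by rewrite ltr_wpDl ?ltW // ltr_nat.
have happrox : approx_iso P X0 h e.
  split=> // x X0x; rewrite ?hiso ?h_P // ?subrr ?normr0.
  - by rewrite ler_piMl // gerBl ltW.
  - by rewrite ler_peMl // lerDl ltW.
  - by rewrite mulr_ge0 // ltW.
have [H [Hb Hn HP HX]] := approx_iso_isometry Kc Ple P_lG sepV fX0 fX1 h_maps e0 e1 happrox.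
exists H; split=> //; apply: le_lt_trans (_ : (24 * e)%:E < _)%E.
  by apply: opnorm_le => //; rewrite mulr_ge0 ?ler0n // ltW.
by rewrite lte_fin.
Qed.
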